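(* Suppose $Q$ is a pentaform and $J'\subseteq J$, where $J=\pi_J(Q)$. Then (a) $\bigcup\{Q_j\mid j\in J'\}$ satisfies [Pij], [Pjw], [Pwa], [Pway], [Pay], [Pwy], and [Py]. Hence (b) $\bigcup\{Q_j\mid j\in J'\}$ is a pentaform if and only if it satisfies [Pr].
   Context: A quintuple $\langle i,j,w,a,y\rangle$ has arbitrary objects as components, called player, situation, decision node, action, successor node. Decision nodes and successor nodes are both nodes (the same object may occur as both). A quintuple set $Q$ is a (possibly infinite) set of quintuples. For a string of letters from $I,J,W,A,Y$, $\pi_{\cdots}(Q)$ is the projection of $Q$ onto those coordinates, in the order listed, e.g. $\pi_{JI}(Q)=\{\langle j,i\rangle\mid \exists w,a,y:\ \langle i,j,w,a,y\rangle\in Q\}$. Write $J=\pi_J(Q)$, $W=\pi_W(Q)$, $Y=\pi_Y(Q)$. For $j\in J$, the slice is $Q_j=\{\langle i_*,j_*,w_*,a_*,y_*\rangle\in Q\mid j_*=j\}$. A function is a set $f$ of couples such that $\langle x,z\rangle,\langle x,z'\rangle\in f$ implies $z=z'$. The axioms for a quintuple set $Q$ are: [Pij] $\pi_{JI}(Q)$ is a function; [Pjw] $\pi_{WJ}(Q)$ is a function; [Pwa] for all $j\in J$, $\pi_{WA}(Q_j)$ is a Cartesian product; [Pway] $\{\langle\langle w,a\rangle,y\rangle\mid\langle w,a,y\rangle\in\pi_{WAY}(Q)\}$ is a function; [Pwy] $\pi_{YW}(Q)$ is a function, denoted $p$; [Pay] $\pi_{YA}(Q)$ is a function; [Py] (given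 [Pwy]) for every $y\in Y$ there is $m\ge1$ with $p^m(y)\notin Y$ (iterates of $p$ from $y$ eventually leave $Y$); [Pr] $W\smallsetminus Y$ is a singleton. A pentaform is a quintuple set satisfying all eight axioms. When an axiom is asserted for another quintuple set, all derived objects are taken from that set. *)

(* Defs.v *)
From mathcomp Require Import all_boot classical_sets.

Set Implicit Arguments.
Unset Strict Implicit.
Unset Printing Implicit Defensive.

Local Open Scope classical_set_scope.

(* Decision nodes and successor nodes share the type [N], so that one object
   may be both; the axioms never compare two components of different types. *)
Record quintuple (I J N A : Type) := Quintuple {
  player : I;
  situation : J;
  decision_node : N;
  action : A;
  successor_node : N }.

(* Functions as sets of couples, hence possibly partial on the ambient type. *)
Definition is_function (X Z : Type) (f : set (X * Z)) : Prop :=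
  forall x z z', f (x, z) -> f (x, z') -> z = z'.

Definition is_cartesian_product (X Z : Type) (R : set (X * Z)) : Prop :=
  exists B C, R = B `*` C.

Definition is_singleton (X : Type) (S : set X) : Prop := exists x, S = [set x].

(* The m-fold iterate, as the set of couples (x, p^m(x)); [B \; A] applies [A]
   first. For a partial function [p] the iterate is undefined at [x] (no couple
   has first component [x]) once the iteration has left the domain of [p]. *)
Fixpoint iterate (X : Type) (p : set (X * X)) (m : nat) : set (X * X) :=
  if m is m'.+1 then (p \; iterate p m')%relation else diagonal.

Section Pentaforms.

Variables I J N A : Type.

Implicit Types Q : set (quintuple I J N A).

Definition pi_J Q : set J := [set situation q | q in Q].
Definition pi_W Q : set N := [set decision_node q | q in Q].
Definition pi_Y Q : set N := [set successor_node q | q in Q].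
Definition pi_JI Q : set (J * I) := [set (situation q, player q) | q in Q].
Definition pi_WJ Q : set (N * J) :=
  [set (decision_node q, situation q) | q in Q].
Definition pi_WA Q : set (N * A) := [set (decision_node q, action q) | q in Q].
Definition pi_WA_Y Q : set (N * A * N) :=
  [set (decision_node q, action q, successor_node q) | q in Q].
Definition pi_YW Q : set (N * N) :=
  [set (successor_node q, decision_node q) | q in Q].
Definition pi_YA Q : set (N * A) := [set (successor_node q, action q) | q in Q].

Definition slice Q (j : J) : set (quintuple I J N A) :=
  [set q | Q q /\ situation q = j].

Definition Pij Q : Prop := is_function (pi_JI Q).
Definition Pjw Q : Prop := is_function (pi_WJ Q).
Definition Pwa Q : Prop :=
  forall j, pi_J Q j -> is_cartesian_product (pi_WA (slice Q j)).
Definition Pway Q : Prop := is_function (pi_WA_Y Q).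
Definition Pwy Q : Prop := is_function (pi_YW Q).
Definition Pay Q : Prop := is_function (pi_YA Q).

(* Only meaningful together with [Pwy], which makes [pi_YW Q] the function p. *)
Definition Py Q : Prop :=
  forall y, pi_Y Q y ->
    exists2 m, (1 <= m)%N &
      exists2 z, iterate (pi_YW Q) m (y, z) & ~ pi_Y Q z.

Definition Pr Q : Prop := is_singleton (pi_W Q `\` pi_Y Q).

Record pentaform Q : Prop := Pentaform {
  pentaform_Pij : Pij Q;
  pentaform_Pjw : Pjw Q;
  pentaform_Pwa : Pwa Q;
  pentaform_Pway : Pway Q;
  pentaform_Pwy : Pwy Q;
  pentaform_Pay : Pay Q;
  pentaform_Py : Py Q;
  pentaform_Pr : Pr Q }.

End Pentaforms.

(* Main.v *)
Require Import Defs.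
From mathcomp Require Import all_boot classical_sets boolp.

Local Open Scope classical_set_scope.

(** The union [Q'] is a subset of [Q], and projections are monotone, so the five axioms asserting
    that a projection is a function pass down by [is_function_sub]. [Pwa] survives because [Q'] is
    made of whole slices ([slice_bigcup]). For [Py], a backward path that leaves [Y] must also leave
    the smaller [Y'] ([Py_sub]). Only [Pr] remains to be asked, which gives (b). *)

Lemma is_function_sub (X Z : Type) (f g : set (X * Z)) :
  f `<=` g -> is_function g -> is_function f.
Proof. by move=> fg gfun x z z' /fg xz /fg xz'; exact: gfun xz xz'. Qed.

Lemma slice_bigcup (I J N A : Type) (Q : set (quintuple I J N A))
    (J' : set J) (j : J) :
  J' j -> slice (\bigcup_(k in J') slice Q k) j = slice Q j.
Proof.
move=> J'j; apply/seteqP; split=> q /= [].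
  by move=> [k _ [Qq _]] qj.
by move=> Qq qj; split=> //; exists j.
Qed.

(** The recursion of [iterate] isolates the last application of [p]; the induction in [Py_sub] needs
    the first one. *)
Lemma iterateSr (X : Type) (p : set (X * X)) (m : nat) :
  iterate p m.+1 = (iterate p m \; p)%relation.
Proof.
elim: m => [|m IHm].
  by apply/seteqP; split=> -[x z] /= [y]; rewrite /diagonal /=;
    [move=> -> yz; exists z | move=> xy <-; exists x].
rewrite -[LHS]/(p \; iterate p m.+1)%relation [in LHS]IHm.
apply/seteqP; split=> -[x z] /= [y].
  by move=> [t xt ty] yz; exists t => //; exists y.
by move=> xy [t yt tz]; exists t => //; exists y.
Qed.

(* The predecessor function of [Q'] restricts that of [Q], so the iterates from
   a node of [Y'] agree with those in [Q] until they leave [Y']. *)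
Lemma Py_sub (I J N A : Type) (Q Q' : set (quintuple I J N A)) :
  Q' `<=` Q -> Pwy Q -> Py Q -> Py Q'.
Proof.
move=> Q'Q pfun exitQ y Y'y.
have YS : pi_Y Q' `<=` pi_Y Q by exact: image_subset.
have [m + [z]] := exitQ y (YS y Y'y).
elim: m y Y'y => // m IHm y [q Q'q <-] _; rewrite iterateSr => -[w /= qwQ wz] zNY.
(* The quintuple [q] putting y in [Y'] lies in [Q'], so it also witnesses the first step of the path
   inside [Q']. *)
have wq : w = decision_node q.
  by apply: (pfun _ _ _ qwQ); exists q; first exact: Q'Q.
have qw : pi_YW Q' (successor_node q, w) by rewrite wq; exists q.
have [Y'w|NY'w] := pselect (pi_Y Q' w); last first.
  by exists 1 => //; exists w => //; exists (successor_node q).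
(* With no step left, w is the exit node z outside [Y], contradicting w in [Y']; otherwise the path
   from w is shorter and still has a step. *)
case: m IHm wz => [_ /diagonalP wz|m IHm wz].
  by case: zNY; rewrite -wz; exact: YS.
have [n _ [z' wz' z'NY]] := IHm w Y'w isT wz zNY.
by exists n.+1 => //; exists z' => //; rewrite iterateSr; exists w.
Qed.

Theorem corollary4p2 (I J N A : Type) (Q : set (quintuple I J N A))
    (J' : set J) :
  pentaform Q -> J' `<=` pi_J Q ->
  let Q' := \bigcup_(j in J') slice Q j in
  (Pij Q' /\ Pjw Q' /\ Pwa Q' /\ Pway Q' /\ Pay Q' /\ Pwy Q' /\ Py Q') /\
  (pentaform Q' <-> Pr Q').
Proof.
case=> ij jw wa way wy ay y _ J'J Q'.
have Q'Q : Q' `<=` Q by move=> q [j _ []].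
have fun_sub X (g : quintuple I J N A -> X) : g @` Q' `<=` g @` Q.
  exact: image_subset.
have ij' : Pij Q' := is_function_sub _ _ _ _ (fun_sub _ _) ij.
have jw' : Pjw Q' := is_function_sub _ _ _ _ (fun_sub _ _) jw.
have way' : Pway Q' := is_function_sub _ _ _ _ (fun_sub _ _) way.
have ay' : Pay Q' := is_function_sub _ _ _ _ (fun_sub _ _) ay.
have wy' : Pwy Q' := is_function_sub _ _ _ _ (fun_sub _ _) wy.
have y' : Py Q' := Py_sub _ _ _ _ _ _ Q'Q wy y.
have wa' : Pwa Q'.
  move=> _ [q [j J'j [_ qj]] <-]; rewrite qj slice_bigcup //.
  exact/wa/J'J.
by split=> //; split=> [[]|].
Qed.
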